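(* Define $f:[1,2]\to[1,2]$ by $$f(x)=\begin{cases}\frac12(x+1)&\text{if }1\le x\le\frac{\log 2}{\log(3/2)},\\ (\log_4 3)\,x&\text{if }\frac{\log 2}{\log(3/2)}\le x\le 2.\end{cases}$$ Then for all $1<\beta<2$, $(f(\beta),\beta)\in F_{1,2}$.
   Context: For finite $A\subset\mathbb{Z}$ and an integer $k$, $A+k\cdot A=\{a_1+ka_2:a_1,a_2\in A\}$. For fixed integers $k,l$, the feasible region $F_{k,l}\subset\mathbb{R}^2$ is the closure of the set $$E_{k,l}=\left\{\left(\frac{\log|A+k\cdot A|}{\log|A|},\frac{\log|A+l\cdot A|}{\log|A|}\right)\right\}$$ as $A$ ranges over finite sets of integers (with $|A|\ge2$, so that the quotients are defined). *)

(* Defs.v *)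
From HB Require Import structures.
From mathcomp Require Import all_boot all_order all_algebra finmap.
From mathcomp Require Import all_classical all_reals all_analysis.
From mathcomp Require Import ring lra.

Set Implicit Arguments.
Unset Strict Implicit.
Unset Printing Implicit Defensive.

Import Order.TTheory GRing.Theory Num.Theory.
Import numFieldNormedType.Exports.

Local Open Scope classical_set_scope.
Local Open Scope ring_scope.

Definition sum_dilate (k : int) (A : {fset int}) : {fset int} :=
  [fset (a1 + k * a2)%R | a1 in A, a2 in A]%fset.

Definition log_ratio (R : realType) (k : int) (A : {fset int}) : R :=
  ln (#|` sum_dilate k A|%:R) / ln (#|` A|%:R).

Definition feasible_points (R : realType) (k l : int) : set (R * R) :=
  [set p | exists2 A : {fset int}, (2 <= #|` A|)%N &
             p = (log_ratio R k A, log_ratio R l A)].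

(* Closure is taken in the product topology of R * R. *)
Definition feasible_region (R : realType) (k l : int) : set (R * R) :=
  closure (feasible_points k l).

(* Only meaningful on [1, 2]; the two formulas agree at the breakpoint
   (lower_curve_break), and lower_curve_itv gives the stated codomain. *)
Definition lower_curve (R : realType) (x : R) : R :=
  if x <= ln 2 / ln (3 / 2) then 2^-1 * (x + 1) else ln 3 / ln 4 * x.

Lemma lower_curve_break (R : realType) (x : R) :
  x = ln 2 / ln (3 / 2) -> 2^-1 * (x + 1) = ln 3 / ln 4 * x.
Proof.
move=> ->.
have l2 : 0 < ln 2 :> R by apply: ln_gt0; lra.
have l32 : 0 < ln (3 / 2) :> R by apply: ln_gt0; lra.
have -> : ln 4 = 2 * ln 2 :> R.
  have -> : 4 = 2 * 2 :> R by lra.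
  by rewrite lnM ?posrE ?ltr0n// mulr_natl mulr2n.
have -> : ln 3 = ln (3 / 2) + ln 2 :> R.
  have {1}-> : 3 = 3 / 2 * 2 :> R by lra.
  by rewrite lnM ?posrE//; lra.
by field; rewrite !gt_eqF.
Qed.

Lemma lower_curve_itv (R : realType) (x : R) :
  1 <= x <= 2 -> 1 <= lower_curve x <= 2.
Proof.
move=> /andP[x1 x2]; rewrite /lower_curve.
have l2 : 0 < ln 2 :> R by apply: ln_gt0; lra.
have l32 : 0 < ln (3 / 2) :> R by apply: ln_gt0; lra.
case: (leP x) => [_|xb]; first by apply/andP; split; lra.
have l4 : 0 < ln 4 :> R by apply: ln_gt0; lra.
have l3 : 0 < ln 3 :> R by apply: ln_gt0; lra.
have l34 : ln 3 <= ln 4 :> R by rewrite ler_ln ?posrE; lra.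
have q1 : ln 3 / ln 4 <= 1 :> R by rewrite ler_pdivrMr// mul1r.
have q0 : 0 < ln 3 / ln 4 :> R by rewrite divr_gt0.
have b1 : 1 <= ln 2 / ln (3 / 2) :> R.
  by rewrite ler_pdivlMr// mul1r ler_ln ?posrE; lra.
have := lower_curve_break (erefl (ln 2 / ln (3 / 2) : R)).
have h : ln 3 / ln 4 * (ln 2 / ln (3 / 2)) <= ln 3 / ln 4 * x.
  by rewrite ler_pM2l// ltW.
move=> e; apply/andP; split; first by lra.
by rewrite (le_trans (y := 1 * x))// ?mul1r // ler_piMl//; lra.
Qed.

(* Main.v *)
Require Import Defs.
From mathcomp Require Import all_boot all_order all_algebra finmap.
From mathcomp Require Import all_classical all_reals all_analysis.
From mathcomp Require Import zify ring lra.

Import Order.TTheory GRing.Theory Num.Theory.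
Import numFieldNormedType.Exports.
Local Open Scope classical_set_scope.
Local Open Scope ring_scope.

(** The curve is the union of two segments, with vertices
      (1, 1),
      P = (ln 3 / ln (9/4), ln 4 / ln (9/4)),  of ordinate ln 2 / ln (3/2),
      Q = (ln 3 / ln 2, 2).
    So it suffices that the feasible region is convex and contains these
    three points.

    Convexity ([feasible_region_convex]).  Writing two finite sets A and B as
    the low and high digits in a large base q gives a set [a + q b] in which
    no carries occur, so that its size and the sizes of its sums of dilates
    are the products of those of A and B ([card_sum_dilate_mul]).  Taking m
    copies of A and n copies of B, the point obtained is the average of the
    points of A and B with weights m ln|A| and n ln|B|; such weights
    approximate any ratio.

    The vertices.  Long intervals tend to (1, 1) and {0, 1} gives Q exactly.
    The point P is the limit of the following sets ([feasible_filled_cube]).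
    Let C be the set of integers with n base-4 digits, all of them 0 or 1;
    then |C| = 2^n, |C + C| = 3^n and |C + 2C| = 4^n, and C + 2C is the
    whole interval [0, 4^n).  Let A be the union of C and the interval
    I = [0, 4^l).  The low l digits of C are absorbed by I, hence I + C has
    about 4^l 2^(n-l) = 2^(n+l) elements.  As long as 2^(n+l) <= 3^n, this
    does not change the order of |A + A|, and A + 2A remains inside an
    interval of length 3 * 4^n.
    Choosing l maximal, 4^l has the order of (9/4)^n, which exceeds
    2^n, so that |A| has this order too. *)

(** * Sums of dilates and digit products *)

(** Plays two roles: [sum_dilate k A] is by definition [dilate_add k A A],
    and for large q the set [dilate_add q A B] is a copy of A x B, with
    low digit in A and high digit in B. *)
Definition dilate_add (q : int) (A B : {fset int}) : {fset int} :=
  [fset (a + q * b)%R | a in A, b in B]%fset.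

Lemma dilate_addP (q : int) (A B : {fset int}) (x : int) :
  reflect (exists a b, [/\ a \in A, b \in B & x = a + q * b])
          (x \in dilate_add q A B).
Proof.
apply: (iffP (imfset2P _ _ _ _ _)).
  by move=> [a aA [b bB ->]]; exists a, b.
by move=> [a [b [aA bB ->]]]; exists a => //; exists b.
Qed.

Lemma mem_dilate_add (q : int) (A B : {fset int}) (a b : int) :
  a \in A -> b \in B -> a + q * b \in dilate_add q A B.
Proof. by move=> aA bB; apply/dilate_addP; exists a, b. Qed.

Lemma dilate_addE (q : int) (A B : {fset int}) :
  dilate_add q A B = [fset x in [seq (a + q * b)%R | a <- A, b <- B]]%fset.
Proof.
apply/fsetP => x; rewrite in_fset; apply/dilate_addP/allpairsP.
  by move=> [a [b [aA bB ->]]]; exists (a, b).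
by move=> [[a b] [aA bB ->]]; exists a, b.
Qed.

Lemma dilate_addS (q : int) (A A' B B' : {fset int}) :
  (A `<=` A' -> B `<=` B' -> dilate_add q A B `<=` dilate_add q A' B')%fset.
Proof.
move=> /fsubsetP sA /fsubsetP sB; apply/fsubsetP => _ /dilate_addP[a [b [aA bB ->]]].
by apply: mem_dilate_add; [exact: sA|exact: sB].
Qed.

Lemma card_dilate_add_le (q : int) (A B : {fset int}) :
  (#|` dilate_add q A B| <= #|` A| * #|` B|)%N.
Proof. by rewrite dilate_addE card_fseq (leq_trans (size_undup _))// size_allpairs. Qed.

(** The elements of A are pairwise distinct modulo q, and q is nonzero as soon
    as A is inhabited: both are contained in this cancellation property. *)
Definition residue_inj (q : int) (A : {fset int}) :=
  {in A &, forall a a' c : int, a = a' + q * c -> c = 0}.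

Lemma card_dilate_add (q : int) (A B : {fset int}) :
  residue_inj q A -> #|` dilate_add q A B| = (#|` A| * #|` B|)%N.
Proof.
move=> qA; rewrite dilate_addE card_fseq undup_id ?size_allpairs//.
apply: allpairs_uniq => [||u v]; rewrite ?fset_uniq//.
case: u v => [a b] [a' b'] /allpairsP[[a1 b1] /= [aA _ [-> ->]]].
move=> /allpairsP[[a2 b2] /= [a'A _ [-> ->]]] /= e.
have e0 : b1 = b2.
  apply/eqP; rewrite eq_sym -subr_eq0; apply/eqP/(qA _ _ aA a'A).
  by rewrite mulrBr addrA -e addrK.
by move: e; rewrite e0 => /addIr ->.
Qed.

(** The map (a, b) |-> a + q b is additive and commutes with dilation. *)
Lemma sum_dilate_dilate_add (k q : int) (A B : {fset int}) :
  sum_dilate k (dilate_add q A B) =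
  dilate_add q (sum_dilate k A) (sum_dilate k B).
Proof.
apply/fsetP => x; apply/(@dilate_addP k)/(@dilate_addP q).
  move=> [_ [_ [/dilate_addP[a [b [aA bB ->]]] /dilate_addP[a' [b' [aA' bB' ->]]] ->]]].
  exists (a + k * a'), (b + k * b'); split; try exact: mem_dilate_add.
  by ring.
move=> [_ [_ [/(@dilate_addP k)[a [a' [aA aA' ->]]] /(@dilate_addP k)[b [b' [bB bB' ->]]] ->]]].
exists (a + q * b), (a' + q * b'); split; try exact: mem_dilate_add.
by ring.
Qed.

(** Any q exceeding the diameter of A separates its elements. *)
Lemma residue_inj_exists (A : {fset int}) :
  exists2 M : int, 0 < M & forall q, M <= q -> residue_inj q A.
Proof.
have [M HM] : exists M : nat, forall a, a \in A -> (`|a| <= M)%N.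
  exists (\max_(a <- A) `|a|)%N => a aA.
  exact: (@leq_bigmax_seq _ (enum_fset A) xpredT (fun a : int => `|a|%N) a).
exists (M.*2.+1%:Z) => // q Mq a a' aA a'A c e.
have := HM _ aA; have := HM _ a'A => h1 h2.
have [//|c0] := eqVneq c 0.
have : (q <= `|q * c|)%R by rewrite normrM; nia.
by move: e; lia.
Qed.

(** The product of A and B in a base so large that neither A nor its two sums
    of dilates produce a carry. *)
Lemma card_sum_dilate_mul (k l : int) (A B : {fset int}) :
  exists D : {fset int},
    [/\ #|` D| = (#|` A| * #|` B|)%N,
        #|` sum_dilate k D| = (#|` sum_dilate k A| * #|` sum_dilate k B|)%N &
        #|` sum_dilate l D| = (#|` sum_dilate l A| * #|` sum_dilate l B|)%N].
Proof.
have [M M0 HM] := residue_inj_exists A.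
have [M1 _ HM1] := residue_inj_exists (sum_dilate k A).
have [M2 _ HM2] := residue_inj_exists (sum_dilate l A).
pose q := Num.max M (Num.max M1 M2).
exists (dilate_add q A B); split.
- by rewrite card_dilate_add//; apply: HM; rewrite /q; lia.
- by rewrite sum_dilate_dilate_add card_dilate_add//; apply: HM1; rewrite /q; lia.
- by rewrite sum_dilate_dilate_add card_dilate_add//; apply: HM2; rewrite /q; lia.
Qed.

Lemma sum_dilate_fset1 (k a : int) :
  sum_dilate k [fset a]%fset = [fset (a + k * a)%R]%fset.
Proof.
apply/fsetP => x; rewrite in_fset1; apply/(@dilate_addP k)/eqP.
  by move=> [b [c [/fset1P-> /fset1P-> ->]]].
by move=> ->; exists a, a; rewrite !fset11.
Qed.

Lemma card_sum_dilate_exp (k l : int) (A B : {fset int}) (m n : nat) :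
  exists D : {fset int},
    [/\ #|` D| = (#|` A| ^ m * #|` B| ^ n)%N,
        #|` sum_dilate k D| =
          (#|` sum_dilate k A| ^ m * #|` sum_dilate k B| ^ n)%N &
        #|` sum_dilate l D| =
          (#|` sum_dilate l A| ^ m * #|` sum_dilate l B| ^ n)%N].
Proof.
elim: m => [|m [D [D0 Dk Dl]]].
  elim: n => [|n [D [D0 Dk Dl]]].
    by exists [fset 0]%fset; rewrite !sum_dilate_fset1 !cardfs1.
  have [E [E0 Ek El]] := card_sum_dilate_mul k l B D.
  by exists E; rewrite E0 Ek El D0 Dk Dl !expnS !mul1n.
have [E [E0 Ek El]] := card_sum_dilate_mul k l A D.
by exists E; rewrite E0 Ek El D0 Dk Dl !expnS !mulnA.
Qed.

(** A + k A contains a translate of A. *)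
Lemma card_sum_dilate_ge (k : int) (A : {fset int}) :
  (#|` A| <= #|` sum_dilate k A|)%N.
Proof.
have [->|[a aA]] := fset_0Vmem A; first by rewrite cardfs0.
rewrite -(card_in_imfset (f := fun x => x + k * a) (p := mem A) tt) /=; last first.
  by move=> x y _ _ /addIr.
apply: fsubset_leq_card; apply/fsubsetP => _ /imfsetP[/= x xA ->].
exact: (@mem_dilate_add k).
Qed.

(** * Intervals and binary digits in base 4 *)

Definition nat_interval (n : nat) : {fset int} :=
  [fset x in [seq Posz i | i <- iota 0 n]]%fset.

Lemma in_nat_interval (n : nat) (x : int) :
  (x \in nat_interval n) = (0 <= x) && (x < n%:Z).
Proof.
rewrite in_fset; apply/mapP/idP => [[i]|]; first by rewrite mem_iota => ? ->; lia.
by case: x => i // ?; exists i => //; rewrite mem_iota; lia.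
Qed.

Lemma card_nat_interval (n : nat) : #|` nat_interval n| = n.
Proof.
rewrite card_fseq undup_id ?size_map ?size_iota//.
by rewrite map_inj_uniq ?iota_uniq// => i j [].
Qed.

Lemma dilate_add_nat_interval (k a b c : nat) (A B : {fset int}) :
  (A `<=` nat_interval a -> B `<=` nat_interval b -> a + k * b <= c ->
  dilate_add k%:Z A B `<=` nat_interval c)%fset%N.
Proof.
move=> /fsubsetP sA /fsubsetP sB abc; apply/fsubsetP => _ /dilate_addP[x [y [xA yB ->]]].
move: (sA _ xA) (sB _ yB); rewrite !in_nat_interval => /andP[? ?] /andP[? ?].
nia.
Qed.

Lemma card_sum_dilate_nat_interval (k n : nat) :
  (#|` sum_dilate k%:Z (nat_interval n)| <= k.+1 * n)%N.
Proof.
rewrite -[leqRHS]card_nat_interval; apply: fsubset_leq_card.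
by apply: (@dilate_add_nat_interval k n n); rewrite ?fsubset_refl//; lia.
Qed.

Definition binary_digits : {fset int} := [fset 0; 1]%fset.

Definition digit_cube (n : nat) : {fset int} :=
  iter n (dilate_add 4 binary_digits) [fset 0]%fset.

Lemma residue_inj_interval (q : nat) (A : {fset int}) :
  (A `<=` nat_interval q)%fset -> residue_inj q A.
Proof.
move=> /fsubsetP sA a a' /sA + /sA + c; rewrite !in_nat_interval => h1 h2 e.
have [//|c0] := eqVneq c 0.
have : (q%:Z <= `|q%:Z * c|)%R by rewrite normrM; nia.
by move: e h1 h2; lia.
Qed.

Lemma binary_digits_interval : binary_digits = nat_interval 2.
Proof. by apply/fsetP => x; rewrite in_nat_interval !inE; lia. Qed.

Lemma sum_dilate_binary (k : int) : k = 1 \/ k = 2 ->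
  sum_dilate k binary_digits = nat_interval (`|k| + 2).
Proof.
rewrite binary_digits_interval.
move=> hk; apply/fsetP => x; rewrite in_nat_interval.
apply/(@dilate_addP k)/idP.
  by move=> [b [c []]]; rewrite !in_nat_interval => ? ? ->; nia.
move=> hx; case: hk => hk; subst k.
  have [x1|x1] := leP x 1; first by exists x, 0; rewrite !in_nat_interval; split; lia.
  by exists 1, (x - 1); rewrite !in_nat_interval; split; lia.
have [x1|x1] := leP x 1; first by exists x, 0; rewrite !in_nat_interval; split; lia.
by exists (x - 2), 1; rewrite !in_nat_interval; split; lia.
Qed.

Lemma card_digit_cube (n : nat) : #|` digit_cube n| = (2 ^ n)%N.
Proof.
elim: n => [|n IH]; first by rewrite cardfs1.
rewrite expnS -IH /= card_dilate_add//.
  by rewrite binary_digits_interval card_nat_interval.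
apply: (@residue_inj_interval 4); rewrite binary_digits_interval.
by apply/fsubsetP => x; rewrite !in_nat_interval; lia.
Qed.

(** The digit sets {0, 1} + {0, 1} = {0, 1, 2} and {0, 1} + 2 {0, 1} =
    {0, 1, 2, 3} still consist of distinct residues modulo 4, so the digits of
    the cube do not interact. *)
Lemma card_sum_dilate_digit_cube (k : int) (n : nat) : k = 1 \/ k = 2 ->
  #|` sum_dilate k (digit_cube n)| = ((`|k| + 2) ^ n)%N.
Proof.
move=> hk; elim: n => [|n IH]; first by rewrite sum_dilate_fset1 cardfs1.
rewrite expnS -IH /= sum_dilate_dilate_add sum_dilate_binary// card_dilate_add//.
  by rewrite card_nat_interval.
apply: (@residue_inj_interval 4).
by apply/fsubsetP => x; rewrite !in_nat_interval; lia.
Qed.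

Lemma digit_cube_split (l m : nat) :
  (digit_cube (l + m)
     `<=` dilate_add (4 ^ l)%N (nat_interval (4 ^ l)) (digit_cube m))%fset.
Proof.
elim: l => [|l /fsubsetP IH]; apply/fsubsetP => x.
  by move=> xC; apply/dilate_addP; exists 0, x; split; rewrite ?in_nat_interval ?add0r ?mul1r.
rewrite addSn /= => /dilate_addP[e [y [eD /IH/dilate_addP[t [z [tI zC ->]]] ->]]].
apply/dilate_addP; exists (e + 4 * t), z; split => //.
  by move: eD tI; rewrite binary_digits_interval !in_nat_interval expnS; lia.
by rewrite expnS; lia.
Qed.

Lemma digit_cube_interval (n : nat) :
  (digit_cube n `<=` nat_interval (4 ^ n))%fset.
Proof.
have /fsubset_trans := digit_cube_split n 0; rewrite addn0; apply.
apply/fsubsetP => _ /dilate_addP[x [y [xI /fset1P-> ->]]].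
by rewrite mulr0 addr0.
Qed.

Lemma mem0_digit_cube (n : nat) : 0 \in digit_cube n.
Proof.
elim: n => [|n IH]; first exact: fset11.
by apply/dilate_addP; exists 0, 0; rewrite mulr0 addr0 !inE.
Qed.

(** * The cube with its low digits filled *)

Definition filled_cube (l m : nat) : {fset int} :=
  (nat_interval (4 ^ l) `|` digit_cube (l + m))%fset.

Lemma card_filled_cube (l m : nat) :
  (4 ^ l <= #|` filled_cube l m| <= 4 ^ l + 2 ^ (l + m))%N.
Proof.
rewrite -[X in (X <= _ <= _)%N]card_nat_interval fsubset_leq_card ?fsubsetUl//=.
by rewrite cardfsU -card_digit_cube !card_nat_interval leq_subr.
Qed.

Lemma card_sum1_filled_cube (l m : nat) :
  (3 ^ (l + m) <= #|` sum_dilate 1 (filled_cube l m)|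
     <= 3 ^ (l + m) + 2 * 2 ^ (l + m + l))%N.
Proof.
have /= <- := card_sum_dilate_digit_cube 1 (l + m) (or_introl erefl).
rewrite fsubset_leq_card ?dilate_addS ?fsubsetUr//=.
(* E contains every sum involving an element of the interval: the low l digits
   of a cube element only widen [0, 4^l) to [0, 2 * 4^l), and its m high digits
   form an element of the smaller cube. *)
pose E := dilate_add (4 ^ l)%N (nat_interval (2 * 4 ^ l)) (digit_cube m).
have cE : (#|` E| <= 2 * 2 ^ (l + m + l))%N.
  rewrite (leq_trans (card_dilate_add_le _ _ _))// card_nat_interval card_digit_cube.
  have -> : (4 ^ l = 2 ^ l * 2 ^ l)%N by rewrite -expnMn.
  by rewrite !expnD; lia.
rewrite addnC (leq_trans _ (leq_add cE (leqnn _)))//.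
apply: (@leq_trans #|` (E `|` sum_dilate 1 (digit_cube (l + m)))%fset|);
  last by rewrite cardfsU leq_subr.
have IE y z : y \in nat_interval (4 ^ l) -> z \in filled_cube l m -> y + z \in E.
  move=> yI; rewrite inE => /orP[zI|/(fsubsetP (digit_cube_split _ _))].
    apply/dilate_addP; exists (y + z), 0; rewrite mem0_digit_cube; split => //; last lia.
    by move: yI zI; rewrite !in_nat_interval; lia.
  move=> /dilate_addP[t [w [tI wC ->]]].
  apply/dilate_addP; exists (y + t), w; split => //; last lia.
  by move: yI tI; rewrite !in_nat_interval; lia.
apply: fsubset_leq_card; apply/fsubsetP => _ /(@dilate_addP 1)[y [z [yA zA ->]]].
rewrite in_fsetU mul1r.
move: (yA); rewrite in_fsetU => /orP[yI|yC]; first by rewrite IE.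
move: (zA); rewrite in_fsetU => /orP[zI|zC]; first by rewrite addrC IE.
by apply/orP; right; apply/(@dilate_addP 1); exists y, z; rewrite mul1r.
Qed.

Lemma card_sum2_filled_cube (l m : nat) :
  (4 ^ (l + m) <= #|` sum_dilate 2 (filled_cube l m)| <= 3 * 4 ^ (l + m))%N.
Proof.
have /= cC := card_sum_dilate_digit_cube 2 (l + m) (or_intror erefl).
rewrite -[X in (X <= _)%N]cC.
rewrite fsubset_leq_card ?dilate_addS ?fsubsetUr//=.
rewrite -[leqRHS]card_nat_interval fsubset_leq_card//.
have sA : (filled_cube l m `<=` nat_interval (4 ^ (l + m)))%fset.
  rewrite fsubUset digit_cube_interval andbT; apply/fsubsetP => x.
  rewrite !in_nat_interval expnD => /andP[-> h] /=.
  have : (0 < 4 ^ m)%N by rewrite expn_gt0.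
  by move: h; nia.
by apply: (@dilate_add_nat_interval 2 _ _ _ _ _ sA sA); lia.
Qed.

(** * Convexity of the feasible region *)

Definition log_card (R : realType) (A : {fset int}) : R := ln #|` A|%:R.

Lemma cvg_slope (R : realType) (u : nat -> R) (a C : R) :
  (forall n, `|u n - n%:R * a| <= C) ->
  u n.+1 / n.+1%:R @[n --> \oo] --> a.
Proof.
move=> uC.
have h0 (s : R) : a + s * harmonic n @[n --> \oo] --> a.
  rewrite -[X in _ --> X]addr0 -[X in _ --> _ + X](mulr0 s).
  by apply: cvgD; [exact: cvg_cst|apply: cvgMr; exact: cvg_harmonic].
apply: (squeeze_cvgr _ (h0 (- C)) (h0 C)); near=> n.
have n0 : 0 < n.+1%:R :> R by rewrite ltr0n.
rewrite /harmonic ler_pdivlMr// ler_pdivrMr// !mulrDl !mulfVK ?gt_eqF//.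
have := uC n.+1; rewrite ler_norml => /andP[? ?].
by apply/andP; split; lra.
Unshelve. all: by end_near. Qed.

(** In the quotients of logarithms only the linear growth rates of the
    logarithms survive. *)
Lemma feasible_of_growth (R : realType) (k l : int) (a b c C : R) : 0 < a ->
  (forall n : nat, exists A : {fset int},
    [/\ `|log_card R A - n%:R * a| <= C,
        `|log_card R (sum_dilate k A) - n%:R * b| <= C &
        `|log_card R (sum_dilate l A) - n%:R * c| <= C]) ->
  feasible_region k l (b / a, c / a).
Proof.
move=> a0 /choice[A HA].
have cA : log_card R (A n.+1) / n.+1%:R @[n --> \oo] --> a.
  by apply: (cvg_slope R (fun n => log_card R (A n)) _ C) => n; case: (HA n).
have cB := cvg_slope R (fun n => log_card R (sum_dilate k (A n))) b C
  (fun n => let: And3 _ h _ := HA n in h).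
have cC := cvg_slope R (fun n => log_card R (sum_dilate l (A n))) c C
  (fun n => let: And3 _ _ h := HA n in h).
have quot (u v x : R) : x != 0 :> R -> u / v = (u / x) / (v / x).
  by move=> x0; rewrite invfM invrK mulrACA mulVf ?mulr1.
have ratio (u : nat -> R) (d : R) : u n.+1 / n.+1%:R @[n --> \oo] --> d ->
    u n.+1 / log_card R (A n.+1) @[n --> \oo] --> d / a.
  move=> cu.
  under eq_fun => n do rewrite (quot _ _ n.+1%:R) ?pnatr_eq0//.
  by apply: cvgM => //; apply: cvgV => //; rewrite gt_eqF.
apply: (closed_cvg (feasible_region k l) _ _ (_, _)
  (cvg_pair (ratio (fun n => log_card R (sum_dilate k (A n))) _ cB)
    (ratio (fun n => log_card R (sum_dilate l (A n))) _ cC))); first exact: closed_closure.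
have : \forall n \near \oo, 0 < log_card R (A n.+1) / n.+1%:R.
  exact: cvgr_gt cA _ a0.
apply: filterS => n; rewrite pmulr_lgt0 ?invr_gt0 ?ltr0n// => An.
apply: subset_closure; exists (A n.+1) => //.
rewrite ltnNge; apply/negP => An1.
move: An; rewrite /log_card; case: #|` A n.+1| An1 => [|[|]]//.
  by rewrite ln0 ?ltxx.
by rewrite ln1 ltxx.
Qed.

(** Use about n t ln|B| copies of A and n (1 - t) ln|A| copies of B; the two
    blocks then contribute to the logarithm of the size in the ratio
    t : 1 - t, and rounding costs a bounded error. *)
Lemma feasible_segment (R : realType) (k l : int) (A B : {fset int}) (t : R) :
  (2 <= #|` A|)%N -> (2 <= #|` B|)%N -> 0 <= t <= 1 ->
  feasible_region k l
    (t * log_ratio R k A + (1 - t) * log_ratio R k B,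
     t * log_ratio R l A + (1 - t) * log_ratio R l B).
Proof.
move=> A2 B2 /andP[t0 t1].
have lA : 0 < log_card R A by rewrite ln_gt0// ltr1n.
have lB : 0 < log_card R B by rewrite ln_gt0// ltr1n.
set m := fun n : nat => Num.truncn (n%:R * (t * log_card R B)).
set p := fun n : nat => Num.truncn (n%:R * ((1 - t) * log_card R A)).
have trP (x : R) : 0 <= x -> `|(Num.truncn x)%:R - x| <= 1.
  by move=> /truncn_itv/andP[? ?]; rewrite ler_norml; lra.
have lB0 : 0 <= t * log_card R B by rewrite mulr_ge0// ltW.
have lA0 : 0 <= (1 - t) * log_card R A by rewrite mulr_ge0// ?subr_ge0// ltW.
have approx (X Y : {fset int}) (n : nat) :
    `|(m n)%:R * log_card R X + (p n)%:R * log_card R Y -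
      n%:R * (t * log_card R B * log_card R X +
              (1 - t) * log_card R A * log_card R Y)| <=
    `|log_card R X| + `|log_card R Y|.
  rewrite [X in `|X|](_ : _ =
      ((m n)%:R - n%:R * (t * log_card R B)) * log_card R X +
      ((p n)%:R - n%:R * ((1 - t) * log_card R A)) * log_card R Y); last by ring.
  rewrite (le_trans (ler_normD _ _))// !normrM lerD// ler_piMl//;
    by apply: trP; rewrite mulr_ge0.
have combine (u v : R) :
    t * (u / log_card R A) + (1 - t) * (v / log_card R B) =
    (t * log_card R B * u + (1 - t) * log_card R A * v) /
    (log_card R A * log_card R B).
  by field; rewrite !gt_eqF.
have self : log_card R A * log_card R B =
    t * log_card R B * log_card R A + (1 - t) * log_card R A * log_card R B.
  by ring.
rewrite /log_ratio -!/(log_card _ _) !combine.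
have lnD (X Y D : {fset int}) (n : nat) : (0 < #|` X|)%N -> (0 < #|` Y|)%N ->
    #|` D| = (#|` X| ^ m n * #|` Y| ^ p n)%N ->
    log_card R D = (m n)%:R * log_card R X + (p n)%:R * log_card R Y.
  move=> X0 Y0; rewrite /log_card => ->.
  rewrite natrM !natrX lnM ?posrE ?exprn_gt0 ?ltr0n//.
  by rewrite !lnXn ?ltr0n// !mulr_natl.
have A1 : (0 < #|` A|)%N by exact: leq_trans A2.
have B1 : (0 < #|` B|)%N by exact: leq_trans B2.
have S1 (j : int) (X : {fset int}) : (0 < #|` X|)%N -> (0 < #|` sum_dilate j X|)%N.
  by move=> X1; exact: leq_trans (card_sum_dilate_ge _ _).
pose E (X Y : {fset int}) := `|log_card R X| + `|log_card R Y|.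
apply: (@feasible_of_growth R k l _ _ _
  (E A B + E (sum_dilate k A) (sum_dilate k B)
         + E (sum_dilate l A) (sum_dilate l B))) => [|n]; first exact: mulr_gt0.
have [D [D0 Dk Dl]] := card_sum_dilate_exp k l A B (m n) (p n).
have E0 X Y : 0 <= E X Y by rewrite addr_ge0.
exists D; split.
- rewrite (lnD A B D n)// self (le_trans (approx _ _ _))//.
  by rewrite -addrA lerDl addr_ge0.
- rewrite (lnD (sum_dilate k A) (sum_dilate k B) _ n) ?S1// (le_trans (approx _ _ _))//.
  by rewrite [E A B + _]addrC -addrA lerDl addr_ge0.
- rewrite (lnD (sum_dilate l A) (sum_dilate l B) _ n) ?S1// (le_trans (approx _ _ _))//.
  by rewrite lerDr addr_ge0.
Qed.

(** The combination of two points is continuous in each of them, so the closure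
    can be taken in one variable at a time. *)
Lemma feasible_region_convex (R : realType) (k l : int) (x y : R * R) (t : R) :
  feasible_region k l x -> feasible_region k l y -> 0 <= t <= 1 ->
  feasible_region k l (t * x.1 + (1 - t) * y.1, t * x.2 + (1 - t) * y.2).
Proof.
move=> + + t01.
pose g (x y : R * R) := (t * x.1 + (1 - t) * y.1, t * x.2 + (1 - t) * y.2).
have affine1 (s d : R) : continuous (fun z : R * R => s * z.1 + d).
  by move=> z; apply: cvgD; [apply: cvgMr; exact: cvg_fst|exact: cvg_cst].
have affine2 (s d : R) : continuous (fun z : R * R => s * z.2 + d).
  by move=> z; apply: cvgD; [apply: cvgMr; exact: cvg_snd|exact: cvg_cst].
have gl y' : continuous (g ^~ y').
  by move=> z; exact: cvg_pair (affine1 _ _ z) (affine2 _ _ z).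
have gr x' : continuous (g x').
  rewrite (_ : g x' = fun z => ((1 - t) * z.1 + t * x'.1, (1 - t) * z.2 + t * x'.2)).
    by move=> z; exact: cvg_pair (affine1 _ _ z) (affine2 _ _ z).
  by apply/funext => z; rewrite /g addrC [X in (_, X)]addrC.
have extend (f : R * R -> R * R) : continuous f ->
    feasible_points k l `<=` f @^-1` feasible_region k l ->
    feasible_region k l `<=` f @^-1` feasible_region k l.
  move=> cf EF.
  have cF : closed (f @^-1` feasible_region k l).
    by apply: (proj1 (continuous_closedP f) cf); exact: closed_closure.
  by rewrite (proj1 (closure_id _) cF); exact: closureS.
move=> + Fy; apply: (extend (g ^~ y)) => // _ [A A2 ->]; move: y Fy.
apply: (extend (g _)) => // _ [B B2 ->].
exact: feasible_segment.
Qed.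

(** * The three vertices *)

Lemma ln_geometric_dist (R : realType) (r C x : R) (n : nat) : 0 < r -> 0 < C ->
  C^-1 * r ^+ n <= x <= C * r ^+ n -> `|ln x - n%:R * ln r| <= ln C.
Proof.
move=> r0 C0 /andP[xl xu].
have rn0 : 0 < r ^+ n by rewrite exprn_gt0.
have x0 : 0 < x by apply: lt_le_trans xl; rewrite mulr_gt0 ?invr_gt0.
have lnr : ln (r ^+ n) = n%:R * ln r by rewrite lnXn// mulr_natl.
rewrite ler_distlC -lnr; apply/andP; split.
  rewrite lerBlDr -lnM ?posrE// ler_ln ?posrE ?mulr_gt0//.
  by rewrite [leRHS]mulrC.
by rewrite -lnM ?posrE// ler_ln ?posrE ?mulr_gt0// mulrC -ler_pdivrMl.
Qed.

Lemma feasible_of_geometric (R : realType) (k l : int) (r s u C : R) :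
  1 < r -> 0 < s -> 0 < u -> 0 < C ->
  (forall n : nat, exists A : {fset int},
    [/\ C^-1 * r ^+ n <= #|` A|%:R <= C * r ^+ n,
        C^-1 * s ^+ n <= #|` sum_dilate k A|%:R <= C * s ^+ n &
        C^-1 * u ^+ n <= #|` sum_dilate l A|%:R <= C * u ^+ n]) ->
  feasible_region k l (ln s / ln r, ln u / ln r).
Proof.
move=> r1 s0 u0 C0 H; apply: (@feasible_of_growth R k l _ _ _ (ln C)).
  exact: ln_gt0.
move=> n; have [A [hr hs hu]] := H n; exists A.
by split; apply: ln_geometric_dist => //; apply: lt_trans r1.
Qed.

Lemma feasible_interval (R : realType) : feasible_region 1 2 (1, 1 : R).
Proof.
have l2 : 0 < ln 2 :> R by apply: ln_gt0; rewrite ltr1n.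
rewrite -(mulfV (lt0r_neq0 l2)).
apply: (@feasible_of_geometric R 1 2 2 2 2 3) => [||||n]; rewrite ?ltr1n//.
exists (nat_interval (2 ^ n)).
have p2 : 0 < (2 : R) ^+ n by rewrite exprn_gt0.
have bound (k : nat) : (k <= 2)%N ->
    3^-1 * (2 : R) ^+ n <= #|` sum_dilate k (nat_interval (2 ^ n))|%:R <= 3 * (2 : R) ^+ n.
  move=> k2.
  have : (2 ^ n <= #|` sum_dilate k (nat_interval (2 ^ n))| <= 3 * 2 ^ n)%N.
    rewrite -[X in (X <= _)%N]card_nat_interval card_sum_dilate_ge/=.
    by rewrite (leq_trans (card_sum_dilate_nat_interval _ _))// leq_mul.
  rewrite -!(ler_nat R) natrM natrX => /andP[h1 h2].
  by lra.
split; [|exact: bound 1 _|exact: bound 2 _].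
rewrite card_nat_interval natrX.
by lra.
Qed.

Lemma feasible_binary (R : realType) :
  feasible_region 1 2 (ln 3 / ln 2, ln 4 / ln 2 : R).
Proof.
apply: subset_closure; exists binary_digits.
  by rewrite binary_digits_interval card_nat_interval.
rewrite /log_ratio !sum_dilate_binary; [|by right|by left].
by rewrite binary_digits_interval !card_nat_interval.
Qed.

(** The largest l with 2^(n+l) <= 3^n, namely l = floor (n log_2 (3/2)); it is at
    most n because 3 <= 4. *)
Lemma fill_level (n : nat) :
  exists l m, [/\ (l + m)%N = n, (2 ^ (n + l) <= 3 ^ n)%N &
                  (3 ^ n < 2 ^ (n + l).+1)%N].
Proof.
have /andP[lo hi] :
    (2 ^ trunc_log 2 (3 ^ n) <= 3 ^ n < 2 ^ (trunc_log 2 (3 ^ n)).+1)%N.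
  by apply: trunc_log_bounds; rewrite ?expn_gt0.
have mono a b : (a <= b)%N -> (a ^ n <= b ^ n)%N.
  by move=> ab; have [->//|n0] := posnP n; rewrite leq_exp2r.
have n_le : (n <= trunc_log 2 (3 ^ n))%N.
  by apply: trunc_log_max => //; exact: mono.
have le_2n : (trunc_log 2 (3 ^ n) <= n + n)%N.
  rewrite -(leq_exp2l (m := 2))// (leq_trans lo)// addnn -mul2n expnM.
  exact: mono.
exists (trunc_log 2 (3 ^ n) - n)%N, (n + n - trunc_log 2 (3 ^ n))%N.
by rewrite subnKC//; split => //; lia.
Qed.

Lemma feasible_filled_cube (R : realType) :
  feasible_region 1 2 (ln 3 / ln (9 / 4), ln 4 / ln (9 / 4) : R).
Proof.
apply: (@feasible_of_geometric R 1 2 _ _ _ 4) => [||||n]; [lra|lra|lra|lra|].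
have [l [m [lm lo hi]]] := fill_level n.
exists (filled_cube l m).
have /andP[A1 A2] := card_filled_cube l m.
have /andP[S1 S2] := card_sum1_filled_cube l m.
have /andP[T1 T2] := card_sum2_filled_cube l m.
rewrite lm in A2 S1 S2 T1 T2.
have sq (j : nat) : (4 ^ j = 2 ^ j * 2 ^ j)%N by rewrite -expnMn.
(* Squaring the choice of l turns it into 4^l = (9/4)^n up to a factor 4. *)
have fE : (4 ^ l * 4 ^ n = 2 ^ (n + l) * 2 ^ (n + l))%N.
  by rewrite !sq expnD; lia.
have nE : (9 ^ n = 3 ^ n * 3 ^ n)%N by rewrite -expnMn.
have lo2 : (4 ^ l * 4 ^ n <= 9 ^ n)%N by rewrite fE nE leq_mul.
have hi2 : (9 ^ n <= 4 * (4 ^ l * 4 ^ n))%N.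
  have := leq_mul (ltnW hi) (ltnW hi); rewrite fE nE expnS.
  by lia.
have pn (a : nat) : 0 < (a.+1 ^ n)%:R :> R by rewrite ltr0n expn_gt0.
have rE : (9 / 4) ^+ n * (4 ^ n)%:R = (9 ^ n)%:R :> R.
  by rewrite !natrX -exprMn; congr (_ ^+ _); lra.
have r0 : 0 < (9 / 4 : R) ^+ n by apply: exprn_gt0; lra.
have two : (2 ^ n)%:R <= (9 / 4 : R) ^+ n.
  by rewrite natrX; apply: lerXn2r; rewrite ?nnegrE; lra.
have Xl : (4 ^ l)%:R <= (9 / 4 : R) ^+ n.
  by rewrite -(ler_pM2r (pn 3)) rE -natrM ler_nat.
have Xu : (9 / 4 : R) ^+ n <= 4 * (4 ^ l)%:R.
  by rewrite -(ler_pM2r (pn 3)) rE -mulrA -!natrM ler_nat.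
have p3 := pn 2; have p4 := pn 3.
move: A1 A2 S1 S2 T1 T2 lo.
rewrite -!(ler_nat R) !natrM !natrD -[(3 : R) ^+ n]natrX -[(4 : R) ^+ n]natrX.
by split; lra.
Qed.

(** * The two segments *)

Theorem corollary11 (R : realType) (beta : R) :
  1 < beta < 2 -> feasible_region 1 2 (lower_curve beta, beta).
Proof.
move=> /andP[b1 b2].
pose x : R := ln 2; pose y : R := ln (3 / 2).
have y0 : 0 < y by rewrite ln_gt0//; lra.
have yx : y < x by rewrite ltr_ln ?posrE; lra.
have lnD (u v w : R) : 0 < u -> 0 < v -> w = u * v -> ln w = ln u + ln v.
  by move=> u0 v0 ->; rewrite lnM.
have E4 : ln 4 = 2 * x :> R by rewrite (lnD 2 2) -/x; lra.
have E3 : ln 3 = x + y :> R by rewrite (lnD 2 (3 / 2)) -/x -/y; lra.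
have E9 : ln (9 / 4) = 2 * y :> R by rewrite (lnD (3 / 2) (3 / 2)) -/y; lra.
have x2y : x < 2 * y by rewrite -E9 ltr_ln ?posrE; lra.
have FP := @feasible_filled_cube R; have FQ := @feasible_binary R.
rewrite E3 E4 E9 -/x in FP FQ.
have b0 : 1 < x / y by rewrite ltr_pdivlMr// mul1r.
have b3 : x / y < 2 by rewrite ltr_pdivrMr.
have weight (u v : R) : 0 <= u -> u <= v -> 0 < v -> 0 <= u / v <= 1.
  move=> u0 uv v0; apply/andP; split; first by rewrite divr_ge0// ltW.
  by rewrite ler_pdivrMr ?mul1r.
rewrite /lower_curve -/x -/y E3 E4.
(* With x = ln 2 and y = ln (3/2), the vertices are P = ((x + y) / (2 y), x / y)
   and Q = ((x + y) / x, 2); the weight is read off the second coordinate. *)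
case: leP => hb.
  have := feasible_region_convex R 1 2 _ _ ((beta - 1) / (x / y - 1)) FP
    (@feasible_interval R).
  rewrite /= => F.
  have t01 : 0 <= (beta - 1) / (x / y - 1) <= 1.
    by apply: weight; lra.
  have := F t01; congr feasible_region; congr pair; field.
    by rewrite !gt_eqF//; lra.
  by rewrite !gt_eqF//; lra.
have := feasible_region_convex R 1 2 _ _ ((2 - beta) / (2 - x / y)) FP FQ.
rewrite /= => F.
have t01 : 0 <= (2 - beta) / (2 - x / y) <= 1.
  by apply: weight; lra.
have := F t01; congr feasible_region; congr pair; field.
  by rewrite !gt_eqF//; lra.
by rewrite !gt_eqF//; lra.
Qed.
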